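(* Let $Q\subset\mathbb{R}^n$ be convex and closed, and let $f:\mathbb{R}^n\to\mathbb{R}$ be a convex, $M$-Lipschitz, positively homogeneous (of degree 1) function with $0\in\operatorname{int}\partial f(0)$ and $f^*=\min_{x\in Q}f(x)>0$, such that $\gamma_0\|x\|_2\le f(x)$ for all $x\in Q$ with some fixed $\gamma_0>0$. Let $X_*$ be the set of minimizers of $f$ on $Q$ and suppose that for some $\alpha>0$ $$f(x)-f^*\ge\alpha\min_{x_*\in X_*}\|x-x_*\|_2\qquad\forall x\in Q.$$ Let $x_0\in Q$ satisfy $\|x_0\|_2=\min_{x\in Q}\|x\|_2$, and let $$x_{k+1}=Pr_Q\{x_k-h_k\nabla f(x_k)\},\qquad h_k=\frac{f(x_k)-f^*}{\|\nabla f(x_k)\|_2^2},\qquad k\ge0,$$ where $\|\nabla f(x_k)\|_2\neq 0$ for every $k\ge0$. Then for every sufficiently small $\gamma>0$, after $$k\ge\frac{2(\ln 2M-\ln\gamma\gamma_0)}{\ln M^2-\ln(M^2-\alpha^2)}-1$$ iterations one has $$f(x_{k+1})\le(1+\gamma)f^* .$$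
   Context: $\|\cdot\|_2$ is the Euclidean norm, $Pr_Q$ the Euclidean projection onto $Q$, $\partial f(0)$ the subdifferential of $f$ at $0$, and $\nabla f(x)$ an arbitrary subgradient of the convex function $f$ at $x$. $M$-Lipschitz means $|f(x)-f(y)|\le M\|x-y\|_2$. The condition $\nabla f(x_k)\neq0$ is part of the description of the method (otherwise a solution has already been found). *)

(* Defs.v *)
From mathcomp Require Export all_boot all_order all_algebra.
From mathcomp Require Export all_classical all_reals all_analysis.

Set Implicit Arguments.
Unset Strict Implicit.
Unset Printing Implicit Defensive.

Import Order.TTheory GRing.Theory Num.Theory.
Import numFieldNormedType.Exports.

Local Open Scope classical_set_scope.
Local Open Scope ring_scope.

Definition dotv (R : realType) (n : nat) (u v : 'rV[R]_n) : R :=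
  \sum_(i < n) u 0 i * v 0 i.

(* The library norm `|u| on 'rV[R]_n is the sup norm, hence a separate
   definition. The two norms induce the same topology, so that the library's
   [closed] and [interior] are the Euclidean ones. *)
Definition enorm (R : realType) (n : nat) (u : 'rV[R]_n) : R :=
  Num.sqrt (dotv u u).

Definition elipschitz (R : realType) (n : nat) (M : R) (f : 'rV[R]_n -> R) :=
  forall x y : 'rV[R]_n, `|f x - f y| <= M * enorm (x - y).

Definition pos_homogeneous (R : realType) (n : nat) (f : 'rV[R]_n -> R) :=
  forall (t : R) (x : 'rV[R]_n), 0 < t -> f (t *: x) = t * f x.

Definition subdiff (R : realType) (n : nat) (f : 'rV[R]_n -> R)
    (x : 'rV[R]_n) : set 'rV[R]_n :=
  [set g | forall y : 'rV[R]_n, f x + dotv g (y - x) <= f y].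

Definition argmin (R : realType) (T : Type) (A : set T) (F : T -> R) : set T :=
  [set x | A x /\ forall y, A y -> F x <= F y].

(* m = min_(x in A) F x, the minimum being attained. *)
Definition is_min (R : realType) (T : Type) (A : set T) (F : T -> R) (m : R) :=
  exists2 x, argmin A F x & F x = m.

(* p = Pr_Q(y). *)
Definition is_proj (R : realType) (n : nat) (Q : set 'rV[R]_n)
    (y p : 'rV[R]_n) :=
  argmin Q (fun z => enorm (z - y)) p.

(* Main.v *)
Require Import Defs.
From mathcomp Require Import ring lra.
Set Implicit Arguments.
Unset Strict Implicit.
Unset Printing Implicit Defensive.

Import Order.TTheory GRing.Theory Num.Theory.
Import numFieldNormedType.Exports.

Local Open Scope classical_set_scope.
Local Open Scope ring_scope.

(** Projection onto [Q] does not increase the distance to a point of [Q], so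
with the Polyak step size the subgradient inequality gives
[|x_{k+1} - z|^2 <= |x_k - z|^2 - ((f x_k - fstar) / |g_k|)^2] for every minimizer
[z].  Take [z] to be the minimizer nearest to [x_k]: sharpness and [|g_k| <= M]
turn this into a contraction of the squared distance to the set of minimizers
by the factor [1 - alpha^2 / M^2].  The initial distance is at most
[2 fstar / gamma0], because [x_0] is no longer than a minimizer, and [f] exceeds
[fstar] by at most [M] times the distance.  Every [gamma > 0] is small enough. *)

(** * Euclidean inner product, nearest points and projections *)

Section Euclidean.
Variables (R : realType) (n : nat).
Implicit Types (u v w x y z p : 'rV[R]_n) (Q A : set 'rV[R]_n) (t : R).

Lemma dotvC u v : dotv u v = dotv v u.
Proof. by apply: eq_bigr => i _; rewrite mulrC. Qed.

Lemma dotvDl u v w : dotv (u + v) w = dotv u w + dotv v w.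
Proof. by rewrite -big_split; apply: eq_bigr => i _; rewrite mxE mulrDl. Qed.

Lemma dotvZl t u v : dotv (t *: u) v = t * dotv u v.
Proof. by rewrite [RHS]mulr_sumr; apply: eq_bigr => i _; rewrite mxE mulrA. Qed.

Lemma dotvNl u v : dotv (- u) v = - dotv u v.
Proof. by rewrite -scaleN1r dotvZl mulN1r. Qed.

Lemma dotvDr u v w : dotv u (v + w) = dotv u v + dotv u w.
Proof. by rewrite dotvC dotvDl !(dotvC u). Qed.

Lemma dotvZr t u v : dotv u (t *: v) = t * dotv u v.
Proof. by rewrite dotvC dotvZl dotvC. Qed.

Lemma dotvNr u v : dotv u (- v) = - dotv u v.
Proof. by rewrite dotvC dotvNl dotvC. Qed.

Definition dotvE := (dotvDl, dotvDr, dotvNl, dotvNr, dotvZl, dotvZr).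

Lemma dotvv_ge0 u : 0 <= dotv u u.
Proof. by apply: sumr_ge0 => i _; rewrite -expr2 sqr_ge0. Qed.

Lemma sqr_enorm u : enorm u ^+ 2 = dotv u u.
Proof. by rewrite sqr_sqrtr ?dotvv_ge0. Qed.

Lemma enorm_ge0 u : 0 <= enorm u.
Proof. exact: sqrtr_ge0. Qed.

Lemma ler_sqr_enorm u v : (enorm u <= enorm v) = (dotv u u <= dotv v v).
Proof. by rewrite -!sqr_enorm ler_sqr ?nnegrE ?enorm_ge0. Qed.

Lemma ler_coord_enorm u i : `|u 0 i| <= enorm u.
Proof.
rewrite -ler_sqr ?nnegrE ?enorm_ge0// sqr_enorm real_normK ?num_real//.
rewrite /dotv (bigD1 i)//= -expr2 lerDl.
by apply: sumr_ge0 => j _; rewrite -expr2 sqr_ge0.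
Qed.

Lemma continuous_enormB x : continuous (fun z => enorm (x - z)).
Proof.
move=> z; apply: (@continuous_comp _ _ _ (fun z => dotv (x - z) (x - z)) Num.sqrt);
  last exact: sqrt_continuous.
apply: cvg_big => [||i _]; [exact: add_continuous|exact: nbhs_filter|].
have h : (x - z) 0 i @[z --> z] --> (x - z) 0 i.
  apply: (@continuous_comp _ _ _ (fun z => x - z) (fun v => v 0 i));
    last exact: coord_continuous.
  by apply: continuousB; [exact: cst_continuous|exact: cvg_id].
exact: (cvgM h h).
Qed.

(** [A] may be unbounded, so the minimum is taken over its intersection with the ball around [x]
    through a point [a] of [A]. That ball lies in a compact box, and points of [A] outside it are
    farther from [x] than [a]. *)
Lemma argmin_dist_nonempty A x : A !=set0 -> closed A ->
  argmin A (fun z => enorm (x - z)) !=set0.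
Proof.
move=> [a Aa] cA.
pose r := enorm (x - a).
pose B := [set z | enorm (x - z) <= r].
have cB : closed B.
  apply: (@closed_comp _ _ (fun z => enorm (x - z)) [set r' | r' <= r]) => //.
  by move=> z _; exact: continuous_enormB.
have kB : compact B.
  have kbox : compact [set v : 'rV[R]_n | forall i, `[x 0 i - r, x 0 i + r]%classic (v 0 i)].
    by apply: (@rV_compact R n (fun i => `[x 0 i - r, x 0 i + r]%classic)) => i;
      exact: segment_compact.
  apply: (subclosed_compact cB kbox).
  move=> z Bz i /=; rewrite in_itv /=.
  have := le_trans (ler_coord_enorm (x - z) i) Bz.
  by rewrite !mxE ler_norml => /andP[? ?]; apply/andP; split; lra.
have kAB : compact (A `&` B).
  apply: (subclosed_compact _ kB); [exact: closedI|by move=> z []].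
have [||c] := EVT_min_rV _ kAB (f := fun z => enorm (x - z)).
- by exists a; split => //; rewrite /B/=.
- by apply: continuous_subspaceT => z; exact: continuous_enormB.
rewrite inE => -[Ac Bc] cmin; exists c; split => // y Ay.
have [yr|/ltW ry] := leP (enorm (x - y)) r; last exact: le_trans Bc ry.
by apply: cmin; rewrite inE.
Qed.

(** With [c] the inner product and [D = |z - p|^2], moving from [p] to [p + t (z - p)] changes the
    squared distance to [y] by [2 t c + t^2 D], which is negative for small [t > 0] if [c < 0]. *)
Lemma is_proj_obtuse Q y p z : convex_set Q -> is_proj Q y p -> Q z ->
  0 <= dotv (p - y) (z - p).
Proof.
move=> Qc [Qp pmin] Qz; rewrite leNgt; apply/negP.
set c := dotv _ _ => c_lt0; have D0 := dotvv_ge0 (z - p).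
set D := dotv _ _ in D0.
have Dc : 0 < D - c by lra.
(* This [t] lies in [[0, 1]], and [t D <= - c] bounds the change by [t c < 0]. *)
pose t := - c / (D - c).
have t0 : 0 <= t by rewrite divr_ge0; lra.
have t1 : t <= 1 by rewrite ler_pdivrMr; lra.
have tE : t * (D - c) = - c by rewrite mulfVK ?gt_eqF.
have Qt : Q (t *: z + (1 - t) *: p).
  by have /set_mem := Qc z p (Itv01 t0 t1) (mem_set Qz) (mem_set Qp).
have := pmin _ Qt.
rewrite /= (_ : t *: z + (1 - t) *: p - y = (p - y) + t *: (z - p)); last first.
  by apply/rowP => i; rewrite !mxE; ring.
rewrite ler_sqr_enorm; move: (p - y) (z - p) @c @D c_lt0 D0 Dc @t t0 t1 tE Qt => a b c D.
move=> c_lt0 D0 Dc t t0 t1 tE Qt.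
rewrite !dotvE (dotvC b a) -/c -/D; nra.
Qed.

Lemma is_proj_dist Q y p z : convex_set Q -> is_proj Q y p -> Q z ->
  enorm (p - z) <= enorm (y - z).
Proof.
move=> Qc Qp Qz; have := is_proj_obtuse Qc Qp Qz.
rewrite ler_sqr_enorm (_ : y - z = (p - z) - (p - y)); last first.
  by rewrite opprB [RHS]addrC addrA subrK.
rewrite -(opprB p z); move: (p - y) (p - z) => a b.
by rewrite !dotvE (dotvC a b); have := dotvv_ge0 a; lra.
Qed.

End Euclidean.

(** * Consequences of the Lipschitz bound *)

Section Subgradient.
Variables (R : realType) (n : nat) (f : 'rV[R]_n -> R) (M : R).
Hypothesis f_lipschitz : elipschitz M f.

Lemma elipschitz_continuous : continuous f.
Proof.
move=> x; have nbhs_x := nbhs_filter x; apply/cvgrPdist_le => e e0.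
have := cvgM (cvg_cst M) (@continuous_enormB R n x x) => /(_ nbhs_x nbhs_x).
move=> /cvgrPdist_le/(_ _ e0); apply: filterS => y.
rewrite subrr [enorm 0]/enorm -(scale0r (0 : 'rV_n)) dotvZl mul0r sqrtr0.
rewrite mulr0 sub0r normrN => /(le_trans (ler_norm _)).
exact: le_trans (f_lipschitz x y).
Qed.

(** Testing the subgradient inequality at [x + g] gives [|g|^2 <= f (x + g) - f x <= M |g|]. *)
Lemma subgradient_le_lipschitz (x g : 'rV[R]_n) :
  subdiff f x g -> enorm g != 0 -> enorm g <= M.
Proof.
move=> /(_ (x + g)); rewrite addrAC subrr add0r -sqr_enorm => h2 g_neq0.
have := f_lipschitz (x + g) x.
rewrite addrAC subrr add0r => /(le_trans (ler_norm _)) h1.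
have g0 : 0 < enorm g by rewrite lt0r g_neq0 enorm_ge0.
by rewrite -(ler_pM2r g0) -expr2; lra.
Qed.

Lemma closed_argmin (Q : set 'rV[R]_n) : closed Q -> closed (argmin Q f).
Proof.
move=> cQ; have [->|/set0P[m [Qm mmin]]] := eqVneq (argmin Q f) set0; first exact: closed0.
rewrite (_ : argmin Q f = Q `&` f @^-1` [set t | t <= f m]); last first.
  apply/seteqP; split => y [Qy ymin]; split => //; first exact: ymin.
  by move=> u /mmin; apply: le_trans.
apply: closedI => //; apply: closed_comp => // y _.
exact: elipschitz_continuous.
Qed.

End Subgradient.

(** * One step of the method *)

Section PolyakStep.
Variables (R : realType) (n : nat) (Q : set 'rV[R]_n) (f : 'rV[R]_n -> R).
Hypothesis Q_convex : convex_set Q.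
Implicit Types x z g p : 'rV[R]_n.

(** Before projection the squared distance to [z] changes by [- 2 h (g . (x - z)) + h^2 |g|^2]. Here
    [g . (x - z) >= f x - f z = h |g|^2], so the change is at most [- h (f x - f z)]. *)
Lemma polyak_step x z g p : Q z -> f z <= f x -> subdiff f x g ->
  enorm g != 0 -> is_proj Q (x - ((f x - f z) / enorm g ^+ 2) *: g) p ->
  enorm (p - z) ^+ 2 <= enorm (x - z) ^+ 2 - ((f x - f z) / enorm g) ^+ 2.
Proof.
move=> Qz fzx /(_ z) sg g0 /is_proj_dist-/(_ _ Q_convex Qz).
set h := _ / _; have h0 : 0 <= h by rewrite divr_ge0 ?sqr_ge0 ?subr_ge0.
have hE : h * enorm g ^+ 2 = f x - f z by rewrite mulfVK ?sqrf_eq0.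
have -> : ((f x - f z) / enorm g) ^+ 2 = h * (f x - f z).
  by rewrite /h; field.
rewrite ler_sqr_enorm !sqr_enorm => /le_trans; apply.
move: sg; rewrite -(opprB x z) (addrAC x) dotvNr.
move: (x - z) => u; rewrite !dotvE (dotvC u g) -(sqr_enorm g) => sg.
have : 0 <= h * (dotv g u - (f x - f z)) by rewrite mulr_ge0; lra.
by rewrite -hE; lra.
Qed.

Variables (M alpha : R).
Hypothesis f_lipschitz : elipschitz M f.
Hypothesis alpha_gt0 : 0 < alpha.

Lemma polyak_contraction x z g p : Q x -> argmin Q f z ->
  alpha * enorm (x - z) <= f x - f z -> subdiff f x g ->
  enorm g != 0 -> is_proj Q (x - ((f x - f z) / enorm g ^+ 2) *: g) p ->
  enorm (p - z) ^+ 2 <= ((M ^+ 2 - alpha ^+ 2) / M ^+ 2) * enorm (x - z) ^+ 2.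
Proof.
move=> Qx [Qz zmin] sharp sg g_neq0 px.
have gM := subgradient_le_lipschitz f_lipschitz sg g_neq0.
have g0 : 0 < enorm g by rewrite lt0r g_neq0 enorm_ge0.
have M0 : 0 < M by exact: lt_le_trans gM.
apply: le_trans (polyak_step Qz (zmin _ Qx) sg g_neq0 px) _.
have -> : (M ^+ 2 - alpha ^+ 2) / M ^+ 2 = 1 - (alpha / M) ^+ 2.
  by field; rewrite gt_eqF.
rewrite [leRHS]mulrBl mul1r lerD2l lerN2 -exprMn ler_sqr ?nnegrE//; first last.
- by rewrite divr_ge0 ?enorm_ge0 ?subr_ge0 ?zmin.
- by rewrite mulr_ge0 ?enorm_ge0// divr_ge0 ?ltW.
rewrite mulrAC ler_pM// ?lef_pV2//.
- by rewrite mulr_ge0 ?enorm_ge0 ?ltW.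
- by rewrite invr_ge0 ltW.
Qed.

End PolyakStep.

(** After taking logarithms the goal is [(k + 1) (ln a - ln b) >= 2 (ln d - ln c)]; the exponent
    [k.+1] accounts for the [- 1] in the threshold. *)
Lemma expr_le_ln_threshold (R : realType) (a b c d : R) (k : nat) :
  0 < b -> b < a -> 0 < c -> 0 < d ->
  2 * (ln d - ln c) / (ln a - ln b) - 1 <= k%:R ->
  (b / a) ^+ k.+1 <= (c / d) ^+ 2.
Proof.
move=> b0 ba c0 d0; have a0 := lt_trans b0 ba.
have L0 : 0 < ln a - ln b by rewrite subr_gt0 ltr_ln.
rewrite lerBlDr ler_pdivrMr// => h.
rewrite -ler_ln ?posrE ?exprn_gt0 ?divr_gt0//.
rewrite (lnXn k.+1) ?divr_gt0// (lnXn 2) ?divr_gt0// !ln_div ?posrE//.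
rewrite -[leLHS]mulr_natl -[leRHS]mulr_natl -natr1.
by lra.
Qed.

Theorem mainTheorem4 (R : realType) (n : nat)
    (Q : set 'rV[R]_n) (f : 'rV[R]_n -> R) (M fstar gamma0 alpha : R)
    (Q_convex : convex_set Q) (Q_closed : closed Q)
    (f_convex : convex_function [set: 'rV[R]_n] f)
    (f_lipschitz : elipschitz M f)
    (f_homogeneous : pos_homogeneous f)
    (int_subdiff0 : (subdiff f 0)° 0)
    (fstar_min : is_min Q f fstar) (fstar_gt0 : 0 < fstar)
    (gamma0_gt0 : 0 < gamma0)
    (f_lower : forall x, Q x -> gamma0 * enorm x <= f x)
    (alpha_gt0 : 0 < alpha)
    (f_sharp : forall (x : 'rV[R]_n) (d : R), Q x ->
      is_min (argmin Q f) (fun xs => enorm (x - xs)) d ->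
      alpha * d <= f x - fstar) :
  exists2 gamma1 : R, 0 < gamma1 &
    forall gamma : R, 0 < gamma -> gamma < gamma1 ->
    (* g k is the chosen subgradient of f at x k *)
    forall (x g : nat -> 'rV[R]_n),
      argmin Q (@enorm R n) (x 0%N) ->
      (forall k : nat, subdiff f (x k) (g k)) ->
      (forall k : nat, enorm (g k) != 0) ->
      (forall k : nat,
         let h := (f (x k) - fstar) / enorm (g k) ^+ 2 in
         is_proj Q (x k - h *: g k) (x k.+1)) ->
    forall k : nat,
      2 * (ln (2 * M) - ln (gamma * gamma0))
        / (ln (M ^+ 2) - ln (M ^+ 2 - alpha ^+ 2)) - 1 <= k%:R ->
      f (x k.+1) <= (1 + gamma) * fstar.
Proof.
exists 1 => // gamma gamma_gt0 _ x g [Qx0 x0min] sg g_neq0 proj k k_ge.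
have [m [Qm mmin] fm] := fstar_min.
have M0 : 0 < M.
  apply: lt_le_trans (subgradient_le_lipschitz f_lipschitz (sg 0) (g_neq0 0)).
  by rewrite lt0r g_neq0 enorm_ge0.
have Qx j : Q (x j) by case: j => // j; case: (proj j).
have fX z : argmin Q f z -> f z = fstar.
  by move=> [Qz zmin]; apply/eqP; rewrite eq_le -fm zmin ?mmin.
pose q := (M ^+ 2 - alpha ^+ 2) / M ^+ 2.
(* [z'] is the minimizer nearest to [x j]. The last clause lets the induction in [rate] switch from
   the previous minimizer [z] to [z'] without losing distance. *)
have step j z : argmin Q f z -> exists z', [/\ argmin Q f z',
    enorm (x j.+1 - z') ^+ 2 <= q * enorm (x j - z') ^+ 2 &
    enorm (x j - z') <= enorm (x j - z)].
  move=> Xz; have [||z' [Xz' z'min]] := @argmin_dist_nonempty _ _ (argmin Q f) (x j).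
  - by exists z.
  - exact: (closed_argmin f_lipschitz).
  exists z'; split => //; last exact: z'min.
  have := proj j; rewrite /= -(fX _ Xz').
  apply: (polyak_contraction Q_convex f_lipschitz) => //.
  by rewrite (fX z')//; apply: f_sharp => //; exists z'.
have close_enough z :
    argmin Q f z -> enorm (x k.+1 - z) <= gamma * fstar / M ->
    f (x k.+1) <= (1 + gamma) * fstar.
  move=> Xz; rewrite ler_pdivlMr// => close.
  have := le_trans (ler_norm _) (f_lipschitz (x k.+1) z).
  by rewrite (fX z)//; lra.
have Xm : argmin Q f m by [].
have [Ma|aM] := leP M alpha.
  (* Here [ln (M ^+ 2 - alpha ^+ 2)] is the junk value [0] and the bound on [k]
     is meaningless, but the contraction factor is [<= 0]: one step is enough. *)
  have [z [Xz z1 _]] := step k m Xm.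
  apply: (close_enough z) => //.
  suff : enorm (x k.+1 - z) ^+ 2 <= 0.
    rewrite real_exprn_even_le0 ?num_real//= => /eqP->.
    by rewrite divr_ge0 ?mulr_ge0 ?ltW.
  apply: le_trans z1 _; rewrite mulr_le0_ge0 ?sqr_ge0//.
  by rewrite mulr_le0_ge0 ?invr_ge0 ?sqr_ge0// subr_le0 ler_sqr ?nnegrE ?(ltW M0) ?(ltW alpha_gt0).
have b0 : 0 < M ^+ 2 - alpha ^+ 2 by rewrite subr_gt0 ltr_sqr ?nnegrE ?(ltW M0) ?(ltW alpha_gt0).
have q0 : 0 <= q by rewrite divr_ge0 ?sqr_ge0 ?ltW.
have x0m : enorm (x 0 - m) ^+ 2 <= (2 * fstar / gamma0) ^+ 2.
  (* |x0 - m|^2 = 2 |x0|^2 + 2 |m|^2 - |x0 + m|^2 <= 4 |m|^2 *)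
  have := dotvv_ge0 (x 0 + m); have := x0min _ Qm.
  rewrite ler_sqr_enorm sqr_enorm !dotvE (dotvC m).
  (* The lower growth bound at [m] reads [gamma0 |m| <= f m = fstar]. *)
  have : enorm m ^+ 2 <= (fstar / gamma0) ^+ 2.
    rewrite ler_sqr ?nnegrE ?enorm_ge0 ?divr_ge0 ?(ltW fstar_gt0) ?(ltW gamma0_gt0)//.
    by rewrite ler_pdivlMr// mulrC -fm f_lower.
  by rewrite sqr_enorm -mulrA [X in _ -> _ -> _ -> _ <= X]exprMn; lra.
have rate j : exists2 z, argmin Q f z &
    enorm (x j - z) ^+ 2 <= q ^+ j * (2 * fstar / gamma0) ^+ 2.
  elim: j => [|j [z Xz zj]]; first by exists m; rewrite // expr0 mul1r.
  have [z' [Xz' z1 z'z]] := step j z Xz; exists z' => //.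
  apply: le_trans z1 _; rewrite (exprS q) -(mulrA q) ler_wpM2l//.
  by apply: le_trans zj; rewrite ler_sqr ?nnegrE ?enorm_ge0.
have [z Xz zk] := rate k.+1; apply: (close_enough z) => //.
rewrite -ler_sqr ?nnegrE ?enorm_ge0//; last by rewrite divr_ge0 ?mulr_ge0 ?ltW.
apply: le_trans zk _.
(* Factoring out the bound on the initial squared distance leaves
   [q ^+ k.+1 <= (gamma gamma0 / (2 M))^2], the form that the logarithmic threshold yields. *)
have -> : (gamma * fstar / M) ^+ 2
    = (gamma * gamma0 / (2 * M)) ^+ 2 * (2 * fstar / gamma0) ^+ 2.
  by field; rewrite !gt_eqF.
rewrite ler_wpM2r ?sqr_ge0//; apply: expr_le_ln_threshold => //.
- by rewrite gtrBl exprn_gt0.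
- exact: mulr_gt0.
- exact: mulr_gt0.
Qed.
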